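(* Let $d\in\{1,2\}$, let $K$ be any simplicial complex on $[m]$ and let $H_d$ be any closed subgroup of $G_d^m$. Then there is a homotopy equivalence \[ (D^d,S^{d-1})^{K}/H_d\simeq \operatorname{hocolim}_{I\in \mathrm{cat}(K)}\ G_d^m/( G_d^I\cdot H_d), \] where the diagram on the right sends $I$ to $G_d^m/(G_d^I\cdot H_d)$ and an inclusion $I\subseteq J$ to the natural projection $G_d^m/(G_d^I\cdot H_d)\to G_d^m/(G_d^J\cdot H_d)$.
   Context: Let $d\in\{1,2\}$; $G_1=\{\pm1\}\cong\mathbb Z/2\mathbb Z\subset\mathbb R$, $G_2=S^1\subset\mathbb C$; $D^1\subset\mathbb R$, $D^2\subset\mathbb C$ are the closed unit disks and $S^{d-1}=\partial D^d$. $K$ is a simplicial complex on the vertex set $[m]=\{1,\dots,m\}$, and $\mathrm{cat}(K)$ is the poset category whose objects are the faces of $K$ together with the empty set, with arrows the inclusions. For $I\subseteq[m]$, $G_d^I\subseteq G_d^m$ denotes the coordinate subgroup of elements whose coordinates outside $I$ equal $1$ ($G_d^\varnothing=\{1\}$). For $I\subseteq[m]$ let $(D^d,S^{d-1})^I=\prod_{i\in I}D^d\times\prod_{j\notin I}S^{d-1}\subseteq (D^d)^m$, and the (real for $d=1$, complex for $d=2$) moment-angle complex is $(D^d,S^{d-1})^K=\bigcup_{I\in K}(D^d,S^{d-1})^I\subseteq (D^d)^m$, with the coordinatewise action of $G_d^m$ (restricted to the closed subgroup $H_d$). $G_d^I\cdot H_d$ denotes the subgroup of $G_d^m$ generated by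 $G_d^I$ and $H_d$. Homotopy colimits are taken in compactly generated Hausdorff spaces. *)

(* Defs.v *)
From HB Require Import structures.
From mathcomp Require Import all_boot all_order all_algebra generic_quotient.
From mathcomp Require Import all_classical all_reals all_analysis.
From Stdlib Require Relation_Operators.
Unset Printing Implicit Defensive.
Import Order.TTheory GRing.Theory Num.Theory.
Import numFieldNormedType.Exports.
Local Open Scope classical_set_scope.
Local Open Scope ring_scope.
Local Open Scope quotient_scope.

Definition eqv {T : Type} (r : T -> T -> Prop) : rel T :=
  fun x y => `[< Relation_Operators.clos_refl_sym_trans T r x y >].

Lemma eqv_refl {T : Type} (r : T -> T -> Prop) : reflexive (eqv r).
Proof. by move=> x; apply/asboolP; apply: Relation_Operators.rst_refl. Qed.
Lemma eqv_sym {T : Type} (r : T -> T -> Prop) : symmetric (eqv r).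
Proof.
move=> x y; apply/idP/idP => /asboolP h; apply/asboolP; exact: Relation_Operators.rst_sym.
Qed.
Lemma eqv_trans {T : Type} (r : T -> T -> Prop) : transitive (eqv r).
Proof.
move=> y x z /asboolP h1 /asboolP h2; apply/asboolP; exact: (Relation_Operators.rst_trans _ _ _ _ _ h1 h2).
Qed.
Canonical eqv_equiv {T : Type} (r : T -> T -> Prop) :=
  EquivRel (eqv r) (eqv_refl r) (eqv_sym r) (eqv_trans r).

Definition quot_space (T : topologicalType) (r : T -> T -> Prop) :=
  quotient_topology {eq_quot (eqv r)}.

Definition unit_interval (R : realType) : set R := [set x : R | 0 <= x <= 1].

Definition homotopic (R : realType) (X Y : topologicalType) (f g : X -> Y) :=
  exists Hm : (X * set_type (unit_interval R))%type -> Y,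
    continuous Hm /\
    (forall x (u : set_type (unit_interval R)), set_val u = 0 -> Hm (x, u) = f x) /\
    (forall x (u : set_type (unit_interval R)), set_val u = 1 -> Hm (x, u) = g x).

Arguments homotopic R {X Y} f g.

Definition homotopy_equivalent (R : realType) (X Y : topologicalType) :=
  exists (f : X -> Y) (g : Y -> X), continuous f /\ continuous g /\
    homotopic R (g \o f) idfun /\ homotopic R (f \o g) idfun.

Definition cmul (R : realType) (z w : R * R) : R * R :=
  (z.1 * w.1 - z.2 * w.2, z.1 * w.2 + z.2 * w.1).
Definition cinv (R : realType) (z : R * R) : R * R := (z.1, - z.2).
Definition cone (R : realType) : R * R := (1, 0).
Definition cnorm2 (R : realType) (z : R * R) : R := z.1 ^+ 2 + z.2 ^+ 2.

(* for d = 1 the ambient line is R = R x {0} inside C; for d = 2 it is C *)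
Definition ambient (R : realType) (d : nat) (z : R * R) : Prop :=
  d <> 1%N \/ z.2 = 0.
Definition disk (R : realType) (d : nat) (z : R * R) : Prop :=
  ambient R d z /\ cnorm2 R z <= 1.
Definition sphere (R : realType) (d : nat) (z : R * R) : Prop :=
  ambient R d z /\ cnorm2 R z = 1.

Definition Cm (R : realType) (m : nat) := {ptws 'I_m -> (R * R)%type}.

Definition gmul (R : realType) (m : nat) (g h : Cm R m) : Cm R m :=
  fun i => cmul R (g i) (h i).
Definition ginv (R : realType) (m : nat) (g : Cm R m) : Cm R m :=
  fun i => cinv R (g i).
Definition gone (R : realType) (m : nat) : Cm R m := fun _ => cone R.

Definition Gm (R : realType) (d m : nat) : set (Cm R m) :=
  [set g | forall i, sphere R d (g i)].
Definition GI (R : realType) (d m : nat) (I : {set 'I_m}) : set (Cm R m) :=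
  [set g | Gm R d m g /\ forall i, i \notin I -> g i = cone R].

Definition closed_subgroup (R : realType) (d m : nat) (H : set (Cm R m)) :=
  [/\ H `<=` Gm R d m, H (gone R m),
      (forall g h, H g -> H h -> H (gmul R m g h)),
      (forall g, H g -> H (ginv R m g)) & closed H].

Definition simplicial_complex (m : nat) (K : {set {set 'I_m}}) :=
  forall I J : {set 'I_m}, I \in K -> J \subset I -> J \in K.

Definition catK (m : nat) (K : {set {set 'I_m}}) : {set {set 'I_m}} :=
  K :|: finset.set1 (finset.set0 : {set 'I_m}).

Definition mac (R : realType) (d m : nat) (K : {set {set 'I_m}}) : set (Cm R m) :=
  [set z | exists2 I, I \in catK m K &
     forall i, (i \in I -> disk R d (z i)) /\ (i \notin I -> sphere R d (z i))].

Definition orbit_rel (R : realType) (d m : nat) (K : {set {set 'I_m}})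
    (H : set (Cm R m)) (z w : set_type (mac R d m K)) : Prop :=
  exists2 h, H h & set_val w = gmul R m h (set_val z).

Definition mac_quot (R : realType) (d m : nat) (K : {set {set 'I_m}})
    (H : set (Cm R m)) := quot_space _ (orbit_rel R d m K H).

Definition coset_rel (R : realType) (d m : nat) (H : set (Cm R m))
    (I : {set 'I_m}) (g g' : set_type (Gm R d m)) : Prop :=
  exists a h, [/\ GI R d m I a, H h & set_val g' = gmul R m (gmul R m a h) (set_val g)].

Definition fib (R : realType) (d m : nat) (H : set (Cm R m)) (I : {set 'I_m}) :=
  quot_space _ (coset_rel R d m H I).

(* the natural projection G^m/(G^I H) -> G^m/(G^J H) (for I \subset J) *)
Definition fib_map (R : realType) (d m : nat) (H : set (Cm R m))
    (I J : {set 'I_m}) (x : fib R d m H I) : fib R d m H J :=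
  \pi_(fib R d m H J) (repr x).

(* ---------- homotopy colimit over cat(K) (nerve / Bousfield-Kan model):
   hocolim F = ( coprod over chains s = (I_0 < ... < I_k) of Delta^s x F(I_0) ) / ~
   where a point (t, x) of Delta^s x F(I_0) lying on the face spanned by the
   chain supp t is identified with (t, F(I_0 <= min (supp t)) x). ---------- *)
Definition is_chain (m : nat) (P s : {set {set 'I_m}}) : bool :=
  [&& s \subset P, s != finset.set0 &
      [forall I in s, [forall J in s, (I \subset J) || (J \subset I)]]].

Definition chain_min (m : nat) (s : {set {set 'I_m}}) : {set 'I_m} :=
  \bigcap_(I in s) I.

Definition simplex (R : realType) (m : nat) (P s : {set {set 'I_m}}) :
    set {ptws {set 'I_m} -> R} :=
  [set t | [/\ is_chain m P s, (forall I, 0 <= t I),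
              (forall I, I \notin s -> t I = 0) & \sum_I t I = 1]].

Definition supp (R : realType) (m : nat) (t : {set 'I_m} -> R) : {set {set 'I_m}} :=
  [set I | t I != 0].

Definition hoc_piece (R : realType) (d m : nat) (K : {set {set 'I_m}})
    (H : set (Cm R m)) (s : {set {set 'I_m}}) :=
  (set_type (simplex R m (catK m K) s) * fib R d m H (chain_min m s))%type.

Definition hoc_total (R : realType) (d m : nat) (K : {set {set 'I_m}})
    (H : set (Cm R m)) := {s : {set {set 'I_m}} & hoc_piece R d m K H s}.

Definition hoc_rel (R : realType) (d m : nat) (K : {set {set 'I_m}})
    (H : set (Cm R m)) (a b : hoc_total R d m K H) : Prop :=
  let t := set_val (projT2 a).1 in
  let u := set_val (projT2 b).1 in
  t = u /\
  fib_map R d m H _ (chain_min m (supp R m t)) (projT2 a).2 =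
  fib_map R d m H _ (chain_min m (supp R m t)) (projT2 b).2.

Definition hocolim_fib (R : realType) (d m : nat) (K : {set {set 'I_m}})
    (H : set (Cm R m)) := quot_space _ (hoc_rel R d m K H).

(* Main.v *)
(** The two spaces are homeomorphic.  A point of the disk is a radius in [0, 1]
together with an element of the circle (or of {1, -1}) that matters only when
the radius is nonzero.  The vectors of radii of points of the moment-angle
complex form the cone on the barycentric subdivision of K, that is the nerve
of cat(K): barycentric coordinates t correspond to the radii
r_i = 1 - \sum_(I containing i) t_I, and the radii vanishing at t are those
indexed by the smallest face in the support of t.  Hence the fibre over t of
the orbit space is G^m / (G^I H), where I is this smallest face, which is also
the fibre of the homotopy colimit.  Both spaces are thus quotients, by the same
equivalence relation, of the disjoint union of the products of a simplex of the
nerve with G^m. *)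
Require Import Defs.
From HB Require Import structures.
From mathcomp Require Import all_boot all_order all_algebra generic_quotient.
From mathcomp Require Import all_classical all_reals all_analysis.
From mathcomp Require Import ring lra.
Import Order.TTheory GRing.Theory Num.Theory.
Import numFieldNormedType.Exports.
Local Open Scope ring_scope.
Local Open Scope quotient_scope.

(** * Weights supported on chains of finite sets *)

(** The total weight is left free, so that the induction in [chain_weights_surj] can lower it. *)
Definition chain_weights (R : realFieldType) (V : finType) (t : {set V} -> R) :=
  (forall I, 0 <= t I) /\
  (forall I J, t I != 0 -> t J != 0 -> (I \subset J) || (J \subset I)).

(** Among the support sets that do not contain [A], which form a chain, take a largest one and an
    element [i] of [A] outside it. Every support set containing [i] then contains [A]. *)
Lemma sum_superset_chain (R : realFieldType) (V : finType) (t : {set V} -> R)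
    (A : {set V}) :
  chain_weights R V t -> A != finset.set0 ->
  exists2 i, i \in A & \sum_(I : {set V} | A \subset I) t I = \sum_(I : {set V} | i \in I) t I.
Proof.
move=> [t0 tc] /set0Pn[a aA].
suff [i iA iP] : exists2 i, i \in A &
    forall I : {set V}, t I != 0 -> i \in I -> A \subset I.
  exists i => //; rewrite [RHS](bigID (fun I : {set V} => A \subset I)) /=.
  rewrite [X in _ + X]big1 ?addr0; last first.
    move=> I /andP[iI AI]; apply/eqP; apply: contraNT AI => tI.
    exact: iP tI iI.
  apply: eq_bigl => I; rewrite andbC.
  by have [/fintype.subsetP/(_ _ iA) ->|] := boolP (A \subset I).
have [/existsP[I0 P0]|/existsPn nP] :=
    boolP [exists I : {set V}, (t I != 0) && ~~ (A \subset I)]; last first.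
  exists a => // I tI _; move: (nP I); rewrite tI /=.
  by rewrite negbK.
case: (@arg_maxnP _ I0 (fun I : {set V} => (t I != 0) && ~~ (A \subset I)) (fun I : {set V} => #|I|) P0).
move=> I /andP[tI AI] Imax.
have /subsetPn[i iA iI] := AI.
exists i => // J tJ iJ; apply/negPn/negP => AJ.
have := Imax J; rewrite tJ AJ => /(_ isT) leJI.
case/orP: (tc I J tI tJ) => [IJ|/fintype.subsetP/(_ _ iJ)]; last exact/negP.
move/negP: iI; apply; rewrite (_ : I = J) //.
by apply/eqP; rewrite eqEcard IJ.
Qed.

(* By [sum_superset_chain], the sum of [t] over the supersets of [A] is the
   minimum over [i \in A] of the sums over the sets containing [i]; the values
   of [t] are then recovered by downward induction on the size of the set. *)
Lemma chain_weights_inj (R : realFieldType) (V : finType) (t u : {set V} -> R) :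
  chain_weights R V t -> chain_weights R V u ->
  \sum_I t I = \sum_I u I ->
  (forall i, \sum_(I : {set V} | i \in I) t I = \sum_(I : {set V} | i \in I) u I) ->
  t = u.
Proof.
move=> ct cu tu1 tui.
(* Only an inequality is direct: with [i] chosen for [w], the sum of [v] over the supersets of [A]
   is at most that over the sets containing [i]. Exchanging the two functions gives equality. *)
have le_sup (v w : {set V} -> R) : chain_weights R V v -> chain_weights R V w ->
    \sum_I v I = \sum_I w I ->
    (forall i, \sum_(I : {set V} | i \in I) v I = \sum_(I : {set V} | i \in I) w I) ->
    forall A : {set V}, \sum_(I : {set V} | A \subset I) v I <= \sum_(I : {set V} | A \subset I) w I.
  move=> cv cw vw1 vwi A; have [->|A0] := eqVneq A finset.set0.
    by under eq_bigl do rewrite finset.sub0set;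
       under [leRHS]eq_bigl do rewrite finset.sub0set; rewrite vw1.
  have [i iA ->] := sum_superset_chain _ _ _ _ cw A0.
  rewrite -vwi big_mkcond [leRHS]big_mkcond; apply: ler_sum => I _.
  case: ifPn => [/fintype.subsetP/(_ _ iA) ->//|_].
  by case: ifP => // _; case: cv.
have sup_eq (A : {set V}) : \sum_(I : {set V} | A \subset I) t I = \sum_(I : {set V} | A \subset I) u I.
  by apply/eqP; rewrite eq_le !le_sup.
apply/funext => A.
have [n] := ubnP (#|V| - #|A|); elim: n A => // n IHn A ltAn.
have := sup_eq A; rewrite (bigD1 A) //= [RHS](bigD1 A) //=.
rewrite (eq_bigr u); first exact: addIr.
move=> I /andP[AI IA]; apply: IHn.
have ltAI : (#|A| < #|I|)%N.
  by apply: proper_card; rewrite finset.properEneq eq_sym IA.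
apply: (leq_trans _ (ltnSE ltAn)).
by apply: ltn_sub2l => //; apply: leq_trans ltAI (max_card _).
Qed.

(* Give the support of [f] the weight [min f], subtract, and iterate. *)
Lemma chain_weights_surj (R : realFieldType) (V : finType) (f : V -> R) (c : R) :
  (forall i, 0 <= f i <= c) -> 0 <= c ->
  exists t : {set V} -> R, [/\ chain_weights R V t,
    forall I, t I != 0 -> I \subset [set i | f i != 0],
    \sum_I t I = c & forall i, \sum_(I : {set V} | i \in I) t I = f i].
Proof.
have [n] := ubnP #|[set i | f i != 0]|.
elim: n f c => // n IHn f c fn f0c c0.
set A := [set i | f i != 0] in fn *.
have [A0|/set0Pn[a aA]] := eqVneq A finset.set0.
  have f0 i : f i = 0.
    by apply/eqP; move/setP/(_ i): A0; rewrite !inE => /negbFE.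
  (* The remaining weight goes to the empty set, which contributes to the total but to no
     coordinate. *)
  exists (fun I => if I == finset.set0 then c else 0); split.
  - split=> [I|I J]; first by case: ifP.
    by case: ifP => [/eqP-> _ _|]; rewrite ?eqxx // finset.sub0set.
  - by move=> I; case: ifP => [/eqP-> _|]; rewrite ?eqxx // finset.sub0set.
  - by rewrite -big_mkcond big_pred1_eq.
  - move=> i; rewrite f0 big1 // => I iI; case: ifP => // /eqP I0.
    by rewrite I0 inE in iI.
case: (@Order.TotalTheory.arg_minP _ _ _ a (mem A) f aA) => b bA bmin.
have {}bA : b \in A by [].
have fb0 : f b != 0 by move: bA; rewrite inE.
pose f' i := if i \in A then f i - f b else 0.
have fbc : 0 <= f b <= c by [].
(* The minimiser [b] drops out of the support, so the induction applies. *)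
have subA : [set i | f' i != 0] \subset A :\ b.
  apply/fintype.subsetP => i; rewrite !inE /f' inE.
  case: (eqVneq i b) => [->|]; first by rewrite fb0 subrr eqxx.
  by case: ifP => //; rewrite eqxx.
have [|||t [[t0 tc] tA t1 ti]] := IHn f' (c - f b).
- apply: leq_trans (ltnSE fn); rewrite (cardsD1 b A) bA ltnS.
  exact: fintype.subset_leq_card.
- move=> i; rewrite /f'; case: ifP => iA; last by lra.
  by have := bmin _ iA; have := f0c i; lra.
- by lra.
(* The support found by induction lies below [A], so it remains a chain once [A] receives weight. *)
have tA' I : t I != 0 -> I \subset A.
  by move=> /tA /fintype.subset_trans; apply; apply: fintype.subset_trans subA (finset.subD1set _ _).
exists (fun I => t I + (if I == A then f b else 0)).
have tAI I : t I + (if I == A then f b else 0) != 0 -> I \subset A.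
  case: ifP => [/eqP-> //|_]; rewrite addr0; exact: tA'.
split => //.
- split=> [I|I J].
    by have := t0 I; case: ifP => _; lra.
  case: (eqVneq I A) => [-> _ /tAI ->|_]; first by rewrite orbT.
  case: (eqVneq J A) => [-> /[!addr0]/tA' -> //|_].
  by rewrite !addr0; exact: tc.
- by rewrite big_split /= t1 -big_mkcond big_pred1_eq subrK.
- move=> i; rewrite big_split /= ti /f' -big_mkcondr /=.
  case: ifP => iA.
    rewrite (big_pred1 A) ?subrK // => I /=.
    by case: eqP => [->|]; rewrite ?iA ?andbF.
  rewrite big_pred0 ?addr0; first by move: iA; rewrite inE => /negbFE/eqP.
  by move=> I /=; case: eqP => [->|]; rewrite ?iA ?andbF.
Qed.

Local Open Scope classical_set_scope.

(** * Quotients, subspaces and continuity *)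

Lemma eqv_const {T U : Type} (r : T -> T -> Prop) (f : T -> U) :
  (forall x y, r x y -> f x = f y) -> forall x y, eqv r x y -> f x = f y.
Proof.
move=> rf x y /asboolP; elim=> {x y} [x y /rf|//|x y _ ->|x y z _ -> _ ->] //.
Qed.

Lemma eqv_equivalence {T : Type} (r : T -> T -> Prop) :
  (forall x, r x x) -> (forall x y, r x y -> r y x) ->
  (forall x y z, r x y -> r y z -> r x z) -> forall x y, eqv r x y -> r x y.
Proof.
move=> rr rs rt x y /asboolP; elim=> {x y} [//|//|x y _ /rs//|x y z _ h _].
exact: rt h.
Qed.

Lemma quot_eqP (T : topologicalType) (r : T -> T -> Prop) (x y : T) :
  reflect (\pi_(quot_space T r) x = \pi_(quot_space T r) y) (eqv r x y).
Proof. exact: eqquotP. Qed.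

Lemma quot_eq (T : topologicalType) (r : T -> T -> Prop) (x y : T) :
  r x y -> \pi_(quot_space T r) x = \pi_(quot_space T r) y.
Proof.
by move=> rxy; apply/quot_eqP/asboolP/Relation_Operators.rst_step.
Qed.

Lemma repr_quot_const (T : topologicalType) (U : Type) (r : T -> T -> Prop)
    (f : T -> U) x :
  (forall x y, r x y -> f x = f y) -> f (repr (\pi_(quot_space T r) x)) = f x.
Proof.
by move=> rf; apply: (eqv_const _ _ rf); apply/quot_eqP; rewrite reprK.
Qed.

Lemma continuous_pair (Z T U : topologicalType) (f : Z -> T) (g : Z -> U) :
  continuous f -> continuous g -> continuous (fun z => (f z, g z)).
Proof. by move=> cf cg z; exact: cvg_pair (cf z) (cg z). Qed.

Definition to_set_type {T : Type} (A : set T) x (Ax : A x) : set_type A :=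
  exist _ x (mem_set Ax).

Lemma continuous_set_val (T : topologicalType) (A : set T) :
  continuous (set_val : set_type A -> T).
Proof. exact: initial_continuous. Qed.

Lemma continuous_to_set_type (Z T : topologicalType) (A : set T)
    (f : Z -> set_type A) : continuous (set_val \o f) -> continuous f.
Proof. exact: continuous_comp_initial. Qed.

(** The image filter clusters at a point of [A], and open sets of the subspace are traces of open
    sets of [T]. *)
Lemma compact_set_type (T : topologicalType) (A : set T) :
  compact A -> compact [set: set_type A].
Proof.
move=> cA F FF _.
have [|p [Ap clp]] := cA (set_val @ F) _.
  by rewrite nbhs_simpl /=; apply: filterE => x; exact: set_valP.
exists (to_set_type A p Ap); split => // B C FB [_ [[W oW <-] /= Wp WC]].
have /clp : (set_val @ F) (set_val @` B).
  by rewrite nbhs_simpl /=; apply: filterS FB => x Bx; exists x.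
move=> /(_ W (open_nbhs_nbhs (conj oW Wp)))[_ [[x Bx <-] Wx]].
by exists x; split => //; exact: WC.
Qed.

Lemma hausdorff_set_type (T : topologicalType) (A : set T) :
  hausdorff_space T -> hausdorff_space (set_type A).
Proof.
move=> hT x y cxy; apply: val_inj; apply: hT => B C nB nC.
have [||z [Bz Cz]] := cxy (set_val @^-1` B) (set_val @^-1` C).
- exact: (continuous_set_val _ A x _ nB).
- exact: (continuous_set_val _ A y _ nC).
by exists (set_val z).
Qed.

Lemma continuous_prod_topology (I : eqType) (Z T : topologicalType)
    (f : Z -> {ptws I -> T}) :
  (forall i, continuous (fun z => f z i)) -> continuous f.
Proof.
move=> cf z; apply/cvg_sup => i.
exact: (@continuous_comp_initial _ _ _ (@proj I (fun=> T) i) f (cf i)).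
Qed.

Lemma continuous_fst (X Y : topologicalType) : continuous (fst : X * Y -> X).
Proof. by move=> x; exact: cvg_fst. Qed.

Lemma continuous_snd (X Y : topologicalType) : continuous (snd : X * Y -> Y).
Proof. by move=> x; exact: cvg_snd. Qed.

Lemma continuous_const (Z T : topologicalType) (a : T) :
  continuous (fun _ : Z => a).
Proof. by move=> z; exact: cvg_cst. Qed.

Lemma continuous_funD (R : realType) (Z : topologicalType) (f g : Z -> R) :
  continuous f -> continuous g -> continuous (fun z => f z + g z).
Proof. by move=> cf cg z; exact: cvgD (cf z) (cg z). Qed.

Lemma continuous_funB (R : realType) (Z : topologicalType) (f g : Z -> R) :
  continuous f -> continuous g -> continuous (fun z => f z - g z).
Proof. by move=> cf cg z; exact: cvgB (cf z) (cg z). Qed.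

Lemma continuous_funM (R : realType) (Z : topologicalType) (f g : Z -> R) :
  continuous f -> continuous g -> continuous (fun z => f z * g z).
Proof. by move=> cf cg z; exact: cvgM (cf z) (cg z). Qed.

Lemma continuous_sum (R : realType) (Z : topologicalType) (I : finType)
    (P : pred I) (f : I -> Z -> R) :
  (forall i, continuous (f i)) -> continuous (fun z => \sum_(i | P i) f i z).
Proof.
move=> cf z; apply: cvg_big => [|i _]; last exact: cf.
apply: continuous_funD; [exact: (continuous_fst R R)|exact: (continuous_snd R R)].
Qed.

Lemma continuous_fun_comp (X Y Z : topologicalType) (f : X -> Y) (g : Y -> Z) :
  continuous f -> continuous g -> continuous (fun x => g (f x)).
Proof. move=> cf cg x; exact: (cvg_comp _ _ (cf x) (cg (f x))). Qed.

Lemma continuous_coord (I : eqType) (T : topologicalType) (i : I) :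
  continuous (fun f : {ptws I -> T} => f i).
Proof. exact: (@proj_continuous _ (fun=> T) i). Qed.

Lemma continuous_sigT (I : choiceType) (X : I -> topologicalType)
    (Z : topologicalType) (f : {i & X i} -> Z) :
  (forall i, continuous (fun x => f (existT X i x))) -> continuous f.
Proof.
by move=> cf [i x] U nU; apply: existT_continuous; exact: cf.
Qed.

(** The preimage under [g] of a closed set is the image under [f] of its preimage in [P]: a compact
    set, hence closed in [Z]. *)
Lemma continuous_compact_surj (P Z Q : topologicalType) (f : P -> Z) (g : Z -> Q) :
  compact [set: P] -> hausdorff_space Z -> continuous f ->
  (forall z, exists p, f p = z) -> continuous (g \o f) -> continuous g.
Proof.
move=> cP hZ cf fsurj /continuous_closedP cgf; apply/continuous_closedP => A clA.
rewrite (_ : g @^-1` A = f @` ((g \o f) @^-1` A)); last first.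
  rewrite eqEsubset; split => [z Agz|_ [p Agfp <-]//].
  by have [p fp] := fsurj z; exists p => //=; rewrite fp.
apply: compact_closed => //; apply: continuous_compact.
  exact: continuous_subspaceT.
by apply: (subclosed_compact _ cP) => //; exact: cgf.
Qed.

(** Openness of [p] turns a product neighbourhood upstairs into one downstairs; for a mere quotient
    map, the product with [S] need not be a quotient map. *)
Lemma continuous_open_surj_prod (S X Y Q : topologicalType) (p : X -> Y)
    (g : S * Y -> Q) :
  (forall U, open U -> open (p @` U)) -> (forall y, exists x, p x = y) ->
  continuous (fun z : S * X => g (z.1, p z.2)) -> continuous g.
Proof.
move=> po psurj cg [s y] W /=; have [x <-] := psurj y => nW.
have [[A B] /= [nA nB] ABW] := cg (s, x) W nW.
exists (A, p @` B^°); first split=> //=.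
  apply: open_nbhs_nbhs; split; first by apply: po; exact: open_interior.
  by exists x.
move=> [a _] /= [Aa [b Bb <-]].
by apply: (ABW (a, b)); split => //=; exact: interior_subset.
Qed.

Lemma continuous_repr_quot (T U : topologicalType) (r : T -> T -> Prop) (f : T -> U) :
  (forall x y, r x y -> f x = f y) -> continuous f ->
  continuous (f \o repr : quot_space T r -> U).
Proof.
move=> rf cf; apply: repr_comp_continuous cf _ => x y /eqP/quot_eqP xy.
by apply/eqP; exact: eqv_const rf _ _ xy.
Qed.

Lemma homotopic_refl (R : realType) (X Y : topologicalType) (f : X -> Y) :
  continuous f -> homotopic R f f.
Proof.
move=> cf; exists (f \o fst); split => //.
exact: continuous_fun_comp (continuous_fst _ _) cf.
Qed.

(** * The coordinate subgroups and their cosets *)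

Section torus_algebra.
Context (R : realType) (d m : nat).
Implicit Types (z w : R * R) (f g h : Cm R m).

Lemma cmulA z w v : cmul R z (cmul R w v) = cmul R (cmul R z w) v.
Proof. by rewrite /cmul /=; congr pair; ring. Qed.

Lemma cmulC z w : cmul R z w = cmul R w z.
Proof. by rewrite /cmul /=; congr pair; ring. Qed.

Lemma cmul1 z : cmul R (cone R) z = z.
Proof. by case: z => a b; rewrite /cmul /=; congr pair; ring. Qed.

(** [cinv] is complex conjugation, which inverts only on the unit circle. *)
Lemma cmulV z : cnorm2 R z = 1 -> cmul R (cinv R z) z = cone R.
Proof.
by case: z => a b; rewrite /cmul /cnorm2 /cone /= => <-; congr pair; ring.
Qed.

Lemma cnorm2M z w : cnorm2 R (cmul R z w) = cnorm2 R z * cnorm2 R w.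
Proof. by rewrite /cnorm2 /cmul /=; ring. Qed.

Lemma cnorm2V z : cnorm2 R (cinv R z) = cnorm2 R z.
Proof. by rewrite /cnorm2 /cinv /= sqrrN. Qed.

Lemma cnorm2_ge0 z : 0 <= cnorm2 R z.
Proof. by rewrite addr_ge0 ?sqr_ge0. Qed.

Lemma gmulA f g h : gmul R m f (gmul R m g h) = gmul R m (gmul R m f g) h.
Proof. by apply/funext => i; exact: cmulA. Qed.

Lemma gmulC f g : gmul R m f g = gmul R m g f.
Proof. by apply/funext => i; exact: cmulC. Qed.

Lemma gmul1 g : gmul R m (gone R m) g = g.
Proof. by apply/funext => i; exact: cmul1. Qed.

Lemma gmulV g : Gm R d m g -> gmul R m (ginv R m g) g = gone R m.
Proof. by move=> Gg; apply/funext => i; apply: cmulV; case: (Gg i). Qed.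

Lemma Gm1 : Gm R d m (gone R m).
Proof.
move=> i; split; first by right.
by rewrite /cnorm2 /= expr1n expr0n addr0.
Qed.

Lemma GmM g h : Gm R d m g -> Gm R d m h -> Gm R d m (gmul R m g h).
Proof.
move=> Gg Gh i; have [[ag ng] [ah nh]] := (Gg i, Gh i); split; last first.
  by rewrite /gmul cnorm2M ng nh mulr1.
case: ag => [?|ag]; first by left.
case: ah => [?|ah]; first by left.
by right; rewrite /gmul /cmul /= ag ah mulr0 mul0r addr0.
Qed.

Lemma GmV g : Gm R d m g -> Gm R d m (ginv R m g).
Proof.
move=> Gg i; have [[ag|ag] ng] := Gg i; split; rewrite /ginv ?cnorm2V //.
  by left.
by right; rewrite /= ag oppr0.
Qed.

Lemma GI1 (I : {set 'I_m}) : GI R d m I (gone R m).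
Proof. by split => //; exact: Gm1. Qed.

Lemma GIM (I : {set 'I_m}) g h :
  GI R d m I g -> GI R d m I h -> GI R d m I (gmul R m g h).
Proof.
move=> [Gg g1] [Gh h1]; split; first exact: GmM.
by move=> i iI; rewrite /gmul g1 // h1 // cmul1.
Qed.

Lemma GIV (I : {set 'I_m}) g : GI R d m I g -> GI R d m I (ginv R m g).
Proof.
move=> [Gg g1]; split; first exact: GmV.
by move=> i iI; rewrite /ginv g1 // /cinv /cone /= oppr0.
Qed.

Lemma GIS (I J : {set 'I_m}) : I \subset J -> GI R d m I `<=` GI R d m J.
Proof.
move=> IJ g [Gg g1]; split => // i iJ; apply: g1.
by apply: contraNN iJ; exact/fintype.subsetP.
Qed.

End torus_algebra.

Section orbits.
Context (R : realType) (d m : nat) (H : set (Cm R m)).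
Hypotheses (HG : H `<=` Gm R d m) (H1 : H (gone R m))
  (HM : forall g h, H g -> H h -> H (gmul R m g h))
  (HV : forall g, H g -> H (ginv R m g)).

Lemma coset_rel_refl (I : {set 'I_m}) g : coset_rel R d m H I g g.
Proof.
by exists (gone R m), (gone R m); split; rewrite ?gmul1 //; exact: GI1.
Qed.

Lemma coset_rel_sym (I : {set 'I_m}) g g' :
  coset_rel R d m H I g g' -> coset_rel R d m H I g' g.
Proof.
move=> [a [h [Ia Hh e]]]; exists (ginv R m a), (ginv R m h).
split; [exact: GIV|exact: HV|rewrite e].
have Ga : Gm R d m a by case: Ia.
rewrite -!gmulA (gmulA _ _ _ a) (gmulC _ _ _ a) -gmulA (gmulA _ _ _ a).
by rewrite (gmulV _ d) // gmul1 gmulA (gmulV _ d) ?gmul1 //; exact: HG.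
Qed.

Lemma coset_rel_trans (I : {set 'I_m}) g g' g'' :
  coset_rel R d m H I g g' -> coset_rel R d m H I g' g'' ->
  coset_rel R d m H I g g''.
Proof.
move=> [a [h [Ia Hh e]]] [b [k [Ib Hk e']]].
exists (gmul R m b a), (gmul R m k h); split; [exact: GIM|exact: HM|].
rewrite e' e !gmulA; congr gmul; rewrite -!gmulA; congr gmul.
by rewrite !gmulA (gmulC _ _ k).
Qed.

(** By commutativity the products of elements of [GI R d m I] and [H] form a subgroup, so
    [coset_rel] already equals the equivalence relation it generates. *)
Lemma fib_eqP (I : {set 'I_m}) g g' :
  \pi_(fib R d m H I) g = \pi_(fib R d m H I) g' <-> coset_rel R d m H I g g'.
Proof.
split=> [/quot_eqP|]; last exact: quot_eq.
apply: eqv_equivalence; [exact: coset_rel_refl|exact: coset_rel_sym|].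
exact: coset_rel_trans.
Qed.

Lemma coset_repr (I : {set 'I_m}) g :
  coset_rel R d m H I g (repr (\pi_(fib R d m H I) g)).
Proof. by apply/fib_eqP; rewrite reprK. Qed.

Lemma coset_relS (I J : {set 'I_m}) g g' : I \subset J ->
  coset_rel R d m H I g g' -> coset_rel R d m H J g g'.
Proof.
by move=> IJ [a [h [Ia Hh e]]]; exists a, h; split => //; exact: GIS Ia.
Qed.

(** [fib_map] goes through a chosen representative; the choice does not matter, since a coset for
    [I] lies in a single coset for [J]. *)
Lemma fib_map_pi (I J : {set 'I_m}) g : I \subset J ->
  fib_map R d m H I J (\pi_(fib R d m H I) g) = \pi_(fib R d m H J) g.
Proof.
move=> IJ; apply/esym/fib_eqP; apply: coset_relS IJ _; exact: coset_repr.
Qed.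

Lemma continuous_gmul (c : Cm R m) : continuous (gmul R m c).
Proof.
apply: continuous_prod_topology => i.
have c1 := continuous_fun_comp _ _ _ _ _ (continuous_coord 'I_m (R * R)%type i) (@continuous_fst R R).
have c2 := continuous_fun_comp _ _ _ _ _ (continuous_coord 'I_m (R * R)%type i) (@continuous_snd R R).
apply: continuous_pair.
  by apply: continuous_funB; apply: continuous_funM => //; exact: continuous_const.
by apply: continuous_funD; apply: continuous_funM => //; exact: continuous_const.
Qed.

(** The saturation of [U] is a union of translates of [U] by the subgroup, each of them open. *)
Lemma fib_pi_open (I : {set 'I_m}) (U : set (set_type (Gm R d m))) :
  open U -> open ((\pi_(fib R d m H I) : _ -> fib R d m H I) @` U).
Proof.
move=> oU.
pose act (c : set_type (Gm R d m)) (g : set_type (Gm R d m)) :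
    set_type (Gm R d m) :=
  to_set_type _ _ (GmM R d m _ _ (set_valP c) (set_valP g)).
pose D := [set c : set_type (Gm R d m) |
  exists a h, [/\ GI R d m I a, H h & set_val c = gmul R m a h]].
have -> : open ((\pi_(fib R d m H I) : _ -> fib R d m H I) @` U) =
    open (\bigcup_(c in D) (act c @^-1` U)).
  rewrite /open /= /quotient_open; congr open.
  rewrite eqEsubset; split => g.
    move=> [g' Ug' /esym/fib_eqP[a [h [Ia Hh e]]]].
    have Gah : Gm R d m (gmul R m a h) by apply: GmM; [case: Ia|exact: HG].
    exists (to_set_type _ _ Gah); first by exists a, h.
    rewrite /= (_ : act _ _ = g') //; apply: val_inj.
    by rewrite -[RHS]/(set_val g') e.
  move=> [c [a [h [Ia Hh e]]]] Ucg; exists (act c g) => //.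
  by apply/esym/fib_eqP; exists a, h; split => //; rewrite -e.
apply: bigcup_open => c _; apply: open_comp => // g _.
apply: continuous_to_set_type => {}g.
apply: (@continuous_comp _ _ _ (set_val : set_type (Gm R d m) -> _) (gmul R m (set_val c))).
  exact: continuous_set_val.
exact: continuous_gmul.
Qed.

End orbits.

(** * Polar coordinates on the moment-angle complex *)

Section polar_coordinates.
Context (R : realType) (m : nat).
Implicit Types (P s : {set {set 'I_m}}) (t u : {set 'I_m} -> R).

Lemma simplexP P s t : simplex R m P s t ->
  [/\ chain_weights R _ t, \sum_I t I = 1, supp R m t \subset s & s \subset P].
Proof.
move=> [/and3P[sP _ sc] t0 ts t1].
have tI I : t I != 0 -> I \in s by apply: contraNT => /ts ->.
split => //; last by apply/fintype.subsetP => I; rewrite inE => /tI.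
split=> // I J /tI sI /tI sJ.
by move/forall_inP: sc => /(_ _ sI) /forall_inP/(_ _ sJ).
Qed.

(* The distance to the origin of the coordinate [i] of a point lying over the
   point of the nerve with barycentric coordinates [t]. *)
Definition radius t (i : 'I_m) : R := 1 - \sum_(I : {set 'I_m} | i \in I) t I.

Lemma radiusE t i : \sum_I t I = 1 ->
  radius t i = \sum_(I : {set 'I_m} | i \notin I) t I.
Proof.
move=> t1; rewrite /radius -t1 [X in X - _](bigID (fun I : {set 'I_m} => i \in I)) /=.
by rewrite addrAC subrr add0r.
Qed.

Lemma radius_ge0 P s t i : simplex R m P s t -> 0 <= radius t i.
Proof. by move=> /simplexP[[t0 _] t1 _ _]; rewrite radiusE ?sumr_ge0. Qed.

Lemma radius_le1 P s t i : simplex R m P s t -> radius t i <= 1.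
Proof.
by move=> /simplexP[[t0 _] _ _ _]; rewrite /radius gerBl sumr_ge0.
Qed.

(** A sum of nonnegative weights vanishes only if all do, so the radius at [i] is zero exactly when
    every set of the support contains [i]. *)
Lemma radius_eq0 P s t i : simplex R m P s t ->
  (radius t i == 0) = (i \in chain_min m (supp R m t)).
Proof.
move=> /simplexP[[t0 _] t1 _ _]; rewrite radiusE // psumr_eq0 //.
apply/allP/bigcapP => [h I|h I _].
  rewrite inE => tI; have := h I (mem_index_enum _).
  by apply: contraLR => iI; rewrite iI.
apply/implyP => iI; apply: contraNT iI => tI.
by apply: h; rewrite inE.
Qed.

Lemma radius_inj P Q s s' t u : simplex R m P s t -> simplex R m Q s' u ->
  radius t =1 radius u -> t = u.
Proof.
move=> /simplexP[ct t1 _ _] /simplexP[cu u1 _ _] tu.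
apply: chain_weights_inj ct cu _ _; first by rewrite t1.
by move=> i; have := tu i; rewrite /radius => /addrI/oppr_inj.
Qed.

(** The largest member of the chain [s] contains every set carrying weight, so nothing is subtracted
    from 1 at a coordinate outside it. *)
Lemma radius_face P s t : simplex R m P s t ->
  exists2 I, I \in P & forall i, i \notin I -> radius t i = 1.
Proof.
move=> sst; have [/and3P[sP /finset.set0Pn[I0 sI0] sc] _ ts _] := sst.
case: (@arg_maxnP _ I0 (mem s) (fun I : {set 'I_m} => #|I|) sI0) => J sJ Jmax.
exists J; first exact: (fintype.subsetP sP).
move=> i iJ; rewrite /radius big1 ?subr0 // => I iI.
apply: ts; apply: contra iJ => sI.
have /orP[/fintype.subsetP/(_ _ iI)//|JI] : (I \subset J) || (J \subset I).
  by move/forall_inP: sc => /(_ _ sI) /forall_inP/(_ _ sJ).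
by rewrite (_ : J = I) //; apply/eqP; rewrite eqEcard JI; exact: Jmax.
Qed.

Lemma radius_surj P (r : 'I_m -> R) : (forall i, 0 <= r i <= 1) ->
  (forall I : {set 'I_m}, I \subset [set i | r i != 1]%SET -> I \in P) ->
  exists s t, simplex R m P s t /\ radius t =1 r.
Proof.
move=> r01 rP.
(* The weights must realise the deficits [1 - r i] with total 1; the support of the result is then
   the chain. *)
have [||t [[t0 tc] tP t1 tr]] := chain_weights_surj R _ (fun i => 1 - r i) 1.
- by move=> i; have := r01 i; lra.
- by [].
exists (supp R m t), t; split; last by move=> i; rewrite /radius tr subKr.
split => //; last by move=> I; rewrite inE negbK => /eqP.
apply/and3P; split.
- apply/fintype.subsetP => I; rewrite inE => /tP tI; apply: rP.
  apply: fintype.subset_trans tI _; apply/fintype.subsetP => i.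
  by rewrite !inE; apply: contraNneq => ->; rewrite subrr.
- apply: contra_eqN t1 => /eqP s0; rewrite big1 1?eq_sym ?oner_eq0 // => I _.
  by apply/eqP; move/setP/(_ I): s0; rewrite !inE => /negbFE.
- apply/forall_inP => I; rewrite inE => tI; apply/forall_inP => J.
  by rewrite inE => tJ; exact: tc.
Qed.

Definition rscale (r : R) (z : R * R) : R * R := (r * z.1, r * z.2).

Lemma cnorm2_rscale r z : cnorm2 R (rscale r z) = r ^+ 2 * cnorm2 R z.
Proof. by rewrite /cnorm2 /rscale /=; ring. Qed.

Lemma cmul_rscale w r z : cmul R w (rscale r z) = rscale r (cmul R w z).
Proof. by rewrite /cmul /rscale /=; congr pair; ring. Qed.

Lemma rscaleK r z : r != 0 -> rscale r^-1 (rscale r z) = z.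
Proof. by move=> r0; case: z => a b; rewrite /rscale /= !mulKf. Qed.

Lemma rscale0 z : rscale 0 z = (0, 0).
Proof. by rewrite /rscale !mul0r. Qed.

Lemma rscale1 z : rscale 1 z = z.
Proof. by case: z => a b; rewrite /rscale !mul1r. Qed.

Lemma rscale_ambient d r z : ambient R d z -> ambient R d (rscale r z).
Proof. by move=> [|z2]; [left|right; rewrite /= z2 mulr0]. Qed.

(** The angle [g i] is lost exactly where the radius vanishes; this is the freedom that the
    coordinate subgroup of the smallest support face describes. *)
Definition polar t (g : Cm R m) : Cm R m := fun i => rscale (radius t i) (g i).

Lemma polar_gmul t h g : polar t (gmul R m h g) = gmul R m h (polar t g).
Proof. by apply/funext => i; rewrite /polar /gmul cmul_rscale. Qed.

Lemma polar_mac d K s t g : simplex R m (catK m K) s t -> Gm R d m g ->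
  mac R d m K (polar t g).
Proof.
move=> st Gg; have [I IK tI] := radius_face _ _ _ st.
exists I => // i; have [ag ng] := Gg i; split=> iI.
  split; first exact: rscale_ambient.
  rewrite cnorm2_rscale ng mulr1 expr_le1 //; first exact: radius_le1 st.
  exact: radius_ge0 st.
by rewrite /polar tI // rscale1.
Qed.

(** Where the radius is nonzero [a] equals 1; elsewhere both sides are 0. *)
Lemma polar_GI d P s t a g : simplex R m P s t ->
  GI R d m (chain_min m (supp R m t)) a -> polar t (gmul R m a g) = polar t g.
Proof.
move=> st [_ a1]; apply/funext => i; rewrite /polar /gmul.
have [->|r0] := eqVneq (radius t i) 0; first by rewrite !rscale0.
by rewrite a1 ?cmul1 // -(radius_eq0 _ _ _ _ st).
Qed.

(** Torus elements have modulus 1, so comparing moduli gives the radii, and these determine the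
    weights. The angles then agree wherever the radius is nonzero. *)
Lemma polar_eq d P s s' t u h g g' :
  simplex R m P s t -> simplex R m P s' u ->
  Gm R d m h -> Gm R d m g -> Gm R d m g' ->
  polar u g' = gmul R m h (polar t g) ->
  t = u /\ exists2 a, GI R d m (chain_min m (supp R m t)) a &
    g' = gmul R m (gmul R m a h) g.
Proof.
move=> st su Gh Gg Gg' e.
have rtu : radius t =1 radius u.
  move=> i; have /(congr1 (cnorm2 R)) := congr1 (fun z : Cm R m => z i) e.
  have [[[_ nh] [_ ng]] [_ ng']] := (Gh i, Gg i, Gg' i).
  rewrite /polar /gmul cnorm2M !cnorm2_rscale nh ng ng' mul1r !mulr1 => /eqP.
  rewrite eqrXn2 ?(radius_ge0 _ _ _ _ st) ?(radius_ge0 _ _ _ _ su) //.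
  by move/eqP.
have tu := radius_inj _ _ _ _ _ _ st su rtu; split => //; subst u.
have Ghg : Gm R d m (gmul R m h g) by exact: GmM.
(* The witness is the quotient of [g'] by [gmul R m h g], which is 1 wherever the radius can be
   cancelled. *)
exists (gmul R m g' (ginv R m (gmul R m h g))); last first.
  by rewrite -!gmulA (gmulV _ d) // gmulC gmul1.
split; first by apply: GmM => //; exact: GmV.
move=> i; rewrite -(radius_eq0 _ _ _ _ st) => r0.
rewrite -polar_gmul in e.
have := congr1 (fun z : Cm R m => rscale (radius t i)^-1 (z i)) e.
rewrite /polar !rscaleK // => e'; rewrite /gmul e' cmulC cmulV //.
by case: (Ghg i).
Qed.

Lemma polar_surj d K z : simplicial_complex m K -> mac R d m K z ->
  exists s t g, [/\ simplex R m (catK m K) s t, Gm R d m g & polar t g = z].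
Proof.
move=> Ksc [I IK zI].
have az i : ambient R d (z i).
  by have [zd zs] := zI i; case: (boolP (i \in I)) => [/zd[]|/zs[]].
have nz i : cnorm2 R (z i) <= 1.
  by have [zd zs] := zI i; case: (boolP (i \in I)) => [/zd[]//|/zs[_ ->]].
pose r i := Num.sqrt (cnorm2 R (z i)).
have r2 i : r i ^+ 2 = cnorm2 R (z i) by rewrite sqr_sqrtr ?cnorm2_ge0.
have [||s [t [st tr]]] := radius_surj (catK m K) r.
- by move=> i; rewrite sqrtr_ge0 /= -sqrtr1 ler_wsqrtr.
(* Coordinates of modulus other than 1 lie in [I], so their subsets are faces, or empty when [I] is
   the empty set added by [catK]. *)
- move=> J /fintype.subsetP JI.
  have {}JI : J \subset I.
    apply/fintype.subsetP => i /JI; rewrite inE; apply: contraNT => iI.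
    by have [_ /(_ iI)[_ ni]] := zI i; rewrite /r ni sqrtr1.
  move: IK; rewrite !inE => /orP[/Ksc/(_ JI) -> //|/eqP I0].
  by move: JI; rewrite I0 finset.subset0 => ->; rewrite orbT.
(* At a zero coordinate any angle would do; 1 is chosen. *)
pose g : Cm R m := fun i => if r i == 0 then cone R else rscale (r i)^-1 (z i).
exists s, t, g; split => //.
- move=> i; rewrite /g; case: ifPn => [_|r0].
    exact: (@Gm1 R d m i).
  split; first exact: rscale_ambient.
  by rewrite cnorm2_rscale -r2 exprVn mulVf // expf_neq0.
- apply/funext => i; rewrite /polar /g tr; case: ifPn => [/eqP r0|r0].
    have : cnorm2 R (z i) == 0 by rewrite -r2 r0 expr0n.
    rewrite paddr_eq0 ?sqr_ge0 // !sqrf_eq0 r0 rscale0.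
    by case: (z i) => a b /= /andP[/eqP-> /eqP->].
  by rewrite -[X in rscale X]invrK rscaleK // invr_eq0.
Qed.

End polar_coordinates.

(** * Compactness of the simplices and the torus, continuity of polar coordinates *)

Section compactness.
Context (R : realType) (m : nat).

Lemma simplex_compact (P s : {set {set 'I_m}}) : compact (simplex R m P s).
Proof.
have [cs|ncs] := boolP (is_chain m P s); last first.
  rewrite (_ : simplex R m P s = set0); first exact: compact0.
  by rewrite -subset0 => t [cs]; rewrite cs in ncs.
(* The simplex is cut out by the total weight from a Tychonoff product of intervals over [s] and
   points elsewhere. *)
pose A (I : {set 'I_m}) : set R := if I \in s then `[0, 1] else [set 0].
rewrite (_ : simplex R m P s =
    [set t : {ptws {set 'I_m} -> R} | forall I, A I (t I)] `&`
    (fun t : {ptws {set 'I_m} -> R} => \sum_I t I) @^-1` [set 1]).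
  apply: compact_closedI.
    apply: (@tychonoff _ (fun=> R) A) => I; rewrite /A.
    by case: ifP => _; [exact: segment_compact|exact: compact_set1].
  apply: preimage_closed; last exact: closed_eq.
  move=> t _; move: t; apply: continuous_sum => I; exact: continuous_coord.
rewrite eqEsubset; split => t.
  move=> [_ t0 ts t1]; split => // I; rewrite /A; case: ifPn => [_|/ts//].
  rewrite /= in_itv /= t0 /= -t1 (bigD1 I) //= lerDl.
  by rewrite sumr_ge0.
move=> [tA t1]; split => // I; have := tA I; rewrite /A.
  by case: ifP => [_|_ -> //]; rewrite /= in_itv => /andP[].
by case: ifP.
Qed.

Lemma sphere_compact d : compact [set z | sphere R d z].
Proof.
have c1 := continuous_fst R R; have c2 := continuous_snd R R.
apply: (@subclosed_compact (R * R)%type _ (`[(-1)%R, 1%R]%classic `*` `[(-1)%R, 1%R]%classic)).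
- rewrite (_ : [set z | _] = [set z | ambient R d z] `&` cnorm2 R @^-1` [set 1]).
    apply: closedI.
      have [d1|/eqP d1] := eqVneq d 1%N; last first.
        rewrite (_ : [set z | _] = setT); first exact: closedT.
        by rewrite -subTset => z _; left.
      rewrite (_ : [set z | _] = snd @^-1` [set 0]).
        by apply: preimage_closed; [move=> z _; exact: c2|exact: closed_eq].
      by rewrite eqEsubset; split => z; [case|right].
    apply: preimage_closed; last exact: closed_eq.
    by move=> z _; move: z; apply: continuous_funD; apply: continuous_funM.
  by rewrite eqEsubset; split.
- by apply: compact_setX; exact: segment_compact.
- move=> [a b] [_]; rewrite /cnorm2 /= => ab1.
  by split; rewrite /= in_itv /=; apply/andP; split; nra.
Qed.

Lemma Gm_compact d : compact (Gm R d m).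
Proof.
apply: (@tychonoff _ (fun=> (R * R)%type) (fun=> [set z | sphere R d z])) => i.
exact: sphere_compact.
Qed.

Lemma continuous_polar : continuous
  (fun p : {ptws {set 'I_m} -> R} * Cm R m => polar R m p.1 p.2 : Cm R m).
Proof.
apply: continuous_prod_topology => i.
have cr : continuous (fun p : {ptws {set 'I_m} -> R} * Cm R m => radius R m p.1 i).
  apply: continuous_funB; first exact: continuous_const.
  apply: continuous_sum => I.
  exact: continuous_fun_comp (continuous_fst _ _) (continuous_coord _ _ I).
have cg : continuous (fun p : {ptws {set 'I_m} -> R} * Cm R m => p.2 i).
  exact: continuous_fun_comp (continuous_snd _ _) (continuous_coord _ _ i).
apply: continuous_pair; apply: continuous_funM => //.
  exact: continuous_fun_comp cg (continuous_fst _ _).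
exact: continuous_fun_comp cg (continuous_snd _ _).
Qed.

End compactness.

(** * The homeomorphism *)

Section homeomorphism.
Context (R : realType) (d m : nat) (K : {set {set 'I_m}}) (H : set (Cm R m)).
Hypotheses (Ksc : simplicial_complex m K) (HG : H `<=` Gm R d m)
  (H1 : H (gone R m)) (HM : forall g h, H g -> H h -> H (gmul R m g h))
  (HV : forall g, H g -> H (ginv R m g)).

Local Notation G := (set_type (Gm R d m)).
Local Notation simp s := (set_type (simplex R m (catK m K) s)).
Local Notation Q := (mac_quot R d m K H).
Local Notation hoc := (hocolim_fib R d m K H).

Definition polar_point (s : {set {set 'I_m}}) (p : simp s * G) :
    set_type (mac R d m K) :=
  to_set_type _ _ (polar_mac R m d K s _ _ (set_valP p.1) (set_valP p.2)).

(** [hoc_point] and [polar_point] parametrise both spaces, before identification, by the same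
    products; [hoc_rel_point] and [orbit_rel_point] compare the identifications. *)
Definition hoc_point (s : {set {set 'I_m}}) (p : simp s * G) :
    hoc_total R d m K H :=
  existT _ s (p.1, \pi_(fib R d m H (chain_min m s)) p.2).

Definition hoc_to_mac (a : hoc_total R d m K H) : Q :=
  \pi_Q (polar_point (projT1 a) ((projT2 a).1, repr (projT2 a).2)).

(** The support is a subfamily of [s], and fewer sets have a larger intersection; hence the fibre at
    [chain_min m s] projects to the one at the support. *)
Lemma chain_min_supp s (t : simp s) :
  chain_min m s \subset chain_min m (supp R m (set_val t)).
Proof.
have [_ _ ts _] := simplexP _ _ _ _ _ (set_valP t).
by apply/bigcapsP => I /(fintype.subsetP ts) sI; exact: finset.bigcap_inf.
Qed.

Lemma hoc_rel_point s s' (p : simp s * G) (q : simp s' * G) :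
  hoc_rel R d m K H (hoc_point s p) (hoc_point s' q) <->
  set_val p.1 = set_val q.1 /\
  coset_rel R d m H (chain_min m (supp R m (set_val p.1))) p.2 q.2.
Proof.
have e (tu : set_val p.1 = set_val q.1) :
    chain_min m s' \subset chain_min m (supp R m (set_val p.1)).
  by rewrite tu; exact: chain_min_supp.
split=> [[/= tu]|[tu pq]].
  rewrite !fib_map_pi //; [|exact: e|exact: chain_min_supp].
  by move=> /fib_eqP; split; auto.
split => //=; rewrite !fib_map_pi //; [|exact: e|exact: chain_min_supp].
exact/fib_eqP.
Qed.

(** The right-hand side is that of [hoc_rel_point]: both relations pull back to the same relation on
    parameters. *)
Lemma orbit_rel_point s s' (p : simp s * G) (q : simp s' * G) :
  orbit_rel R d m K H (polar_point s p) (polar_point s' q) <->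
  set_val p.1 = set_val q.1 /\
  coset_rel R d m H (chain_min m (supp R m (set_val p.1))) p.2 q.2.
Proof.
split=> [[h Hh /= e]|[tu [a [h [aI Hh e]]]]].
  have [tu [a aI e']] := polar_eq R m d (catK m K) s s' _ _ h _ _
    (set_valP p.1) (set_valP q.1) (HG _ Hh) (set_valP p.2) (set_valP q.2) e.
  by split => //; exists a, h.
(* The factor [a] only turns coordinates of radius zero, so [h] alone carries one point to the
   other. *)
exists h => //.
change (polar R m (set_val q.1) (set_val q.2) =
  gmul R m h (polar R m (set_val p.1) (set_val p.2))).
rewrite -tu e -gmulA -polar_gmul.
exact: polar_GI (set_valP p.1) aI.
Qed.

Lemma hoc_to_mac_point s (p : simp s * G) :
  hoc_to_mac (hoc_point s p) = \pi_Q (polar_point s p).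
Proof.
apply/esym/quot_eq/orbit_rel_point; split => //=.
apply: coset_relS (chain_min_supp _ _) _.
exact: coset_repr.
Qed.

Lemma hoc_pointP (a : hoc_total R d m K H) :
  exists s p, a = hoc_point s p.
Proof.
by case: a => s [t x]; exists s, (t, repr x); rewrite /hoc_point /= reprK.
Qed.

Lemma hoc_to_mac_rel a b : hoc_rel R d m K H a b -> hoc_to_mac a = hoc_to_mac b.
Proof.
have [s [p ->]] := hoc_pointP a; have [s' [q ->]] := hoc_pointP b.
move=> /hoc_rel_point/orbit_rel_point pq; rewrite !hoc_to_mac_point.
exact: quot_eq.
Qed.

Lemma continuous_polar_point s : continuous (polar_point s).
Proof.
apply: continuous_to_set_type.
apply: (continuous_fun_comp _ _ _
  (fun p : simp s * G => (set_val p.1, set_val p.2)) _ _ (continuous_polar R m)).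
by apply: continuous_pair; apply: continuous_fun_comp;
  [exact: continuous_fst|exact: continuous_set_val|
   exact: continuous_snd|exact: continuous_set_val].
Qed.

(* The projection onto cosets is open, so its product with a simplex is still a
   quotient map, through which continuity can be tested. *)
Lemma continuous_hoc_to_mac : continuous hoc_to_mac.
Proof.
apply: continuous_sigT => s.
apply: (continuous_open_surj_prod _ _ _ _
  (\pi_(fib R d m H (chain_min m s)) : G -> fib R d m H (chain_min m s))).
- by move=> U; exact: fib_pi_open.
- by move=> x; exists (repr x); exact: reprK.
rewrite (_ : (fun _ => _) = \pi_Q \o polar_point s); last first.
  by apply/funext => p; rewrite -[RHS]hoc_to_mac_point.
apply: continuous_fun_comp; first exact: continuous_polar_point.
exact: pi_continuous.
Qed.

Lemma polar_pointP z : exists s p, polar_point s p = z.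
Proof.
have [s [t [g [st Gg e]]]] := polar_surj R m d K _ Ksc (set_valP z).
exists s, (to_set_type _ _ st, to_set_type _ _ Gg); exact: val_inj.
Qed.

Lemma polar_lift z :
  {a : hoc_total R d m K H | exists s p, polar_point s p = z /\ a = hoc_point s p}.
Proof.
apply: cid; have [s [p e]] := polar_pointP z.
by exists (hoc_point s p), s, p.
Qed.

(** The polar coordinates are an arbitrary choice; [mac_to_hoc_point] shows that the class does not
    depend on it. *)
Definition mac_to_hoc z : hoc := \pi_hoc (sval (polar_lift z)).

Lemma mac_to_hoc_rel z w : orbit_rel R d m K H z w -> mac_to_hoc z = mac_to_hoc w.
Proof.
rewrite /mac_to_hoc.
case: (polar_lift z) => _ /= [s [p [<- ->]]].
case: (polar_lift w) => _ /= [s' [q [<- ->]]].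
by move=> /orbit_rel_point/hoc_rel_point; exact: quot_eq.
Qed.

Lemma mac_to_hoc_point s (p : simp s * G) :
  mac_to_hoc (polar_point s p) = \pi_hoc (hoc_point s p).
Proof.
rewrite /mac_to_hoc; case: (polar_lift _) => _ /= [s' [q [e ->]]].
apply/quot_eq/hoc_rel_point/orbit_rel_point; rewrite e.
(* Two lifts of one point are related through the identity element of [H]. *)
exists (gone R m); first exact: H1.
by rewrite gmul1.
Qed.

(* [polar_point] is a surjection from a compact space to a Hausdorff one, hence a
   quotient map; angles are discontinuous at the origin, so no formula in the
   coordinates of the moment-angle complex would do. *)
Lemma continuous_mac_to_hoc : continuous mac_to_hoc.
Proof.
apply: (continuous_compact_surj {s : {set {set 'I_m}} & (simp s * G)%type} _ _
  (fun p => polar_point (projT1 p) (projT2 p))).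
(* The index [s] ranges over a finite type, so the disjoint union of the compact products is
   compact. *)
- apply: sigT_compact => [|s]; first exact: finite_finset.
  rewrite -setXTT; apply: compact_setX; apply: compact_set_type.
    exact: simplex_compact.
  exact: Gm_compact.
- apply: hausdorff_set_type; apply: (@hausdorff_product _ (fun=> (R * R)%type)).
  move=> _; exact: norm_hausdorff.
- apply: continuous_sigT => s; exact: continuous_polar_point.
- by move=> z; have [s [p <-]] := polar_pointP z; exists (existT _ s p).
rewrite (_ : _ \o _ = fun a => \pi_hoc (hoc_point (projT1 a) (projT2 a))); last first.
  by apply/funext => -[s p] /=; exact: mac_to_hoc_point.
apply: continuous_sigT => s.
apply: (continuous_fun_comp _ _ _ (hoc_point s) (\pi_hoc)); last exact: pi_continuous.
apply: (continuous_fun_comp _ _ _ _ (existT _ s)); last exact: existT_continuous.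
apply: continuous_pair; first exact: continuous_fst.
apply: continuous_fun_comp (continuous_snd _ _) _; exact: pi_continuous.
Qed.

End homeomorphism.

Theorem theorem2p14 (R : realType) (d m : nat) (K : {set {set 'I_m}})
    (H : set (Cm R m)) :
  (d = 1 \/ d = 2)%N ->
  simplicial_complex m K ->
  closed_subgroup R d m H ->
  homotopy_equivalent R (mac_quot R d m K H) (hocolim_fib R d m K H).
Proof.
move=> _ Ksc [HG H1 HM HV _].
(* Each map is defined on its source before identification and descends to the quotient through
   representatives. *)
pose F := hoc_to_mac R d m K H; pose G := mac_to_hoc R d m K H Ksc.
have Frel := hoc_to_mac_rel R d m K H HG H1 HM HV.
have Grel := mac_to_hoc_rel R d m K H Ksc HG H1 HM HV.
have FG z : F (repr (G z)) = \pi_(mac_quot R d m K H) z.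
  have [s [p <-]] := polar_pointP R d m K Ksc z.
  rewrite /F /G mac_to_hoc_point // repr_quot_const //.
  exact: hoc_to_mac_point.
have GF a : G (repr (F a)) = \pi_(hocolim_fib R d m K H) a.
  have [s [p ->]] := hoc_pointP R d m K H a.
  rewrite /F /G hoc_to_mac_point // repr_quot_const //.
  exact: mac_to_hoc_point.
exists (G \o repr), (F \o repr); split; last split.
- apply: continuous_repr_quot Grel _; exact: (continuous_mac_to_hoc R d m K H Ksc HG H1 HM HV).
- apply: continuous_repr_quot Frel _; exact: (continuous_hoc_to_mac R d m K H HG H1 HM HV).
split.
(* Both composites are identities, so constant homotopies suffice. *)
- rewrite (_ : _ \o _ = idfun); first by apply: homotopic_refl => x; exact: cvg_id.
  by apply/funext => x /=; rewrite FG reprK.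
- rewrite (_ : _ \o _ = idfun); first by apply: homotopic_refl => x; exact: cvg_id.
  by apply/funext => x /=; rewrite GF reprK.
Qed.
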